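(* Let $\alpha\in\mathbb{Q}\cap(0,1)$ and $p\in[0,1]$, let $(X_t)_{t\in\mathbb{N}_0}$ be the Antlion Random Walk with parameters $\alpha$ and $p$ started at $X_0=0$, and let $t\in\mathbb{N}$. For any $x\in\mathbb{R}$ such that $\mathbb{P}(X_t=x)>0$, the path of the Antlion Random Walk to $x$ is unique; that is, there is exactly one sequence $(e_1,\dots,e_t)\in\{-1,1\}^t$ of values of $(\xi_1,\dots,\xi_t)$ such that $\sum_{s=1}^{t}\alpha^{t-s}e_s=x$.
   Context: $\mathbb{N}=\{1,2,3,\dots\}$ and $\mathbb{N}_0=\mathbb{N}\cup\{0\}$. Let $(\xi_t)_{t\in\mathbb{N}}$ be independent, identically distributed random variables with $\mathbb{P}(\xi_t=-1)=p$ and $\mathbb{P}(\xi_t=1)=1-p$. The Antlion Random Walk (ARW) with parameters $\alpha$ and $p$ is the real-valued process defined by $X_0=0$ and $X_t=\alpha X_{t-1}+\xi_t$ for $t\in\mathbb{N}$; equivalently $X_t=\sum_{s=1}^{t}\alpha^{t-s}\xi_s$. A path up to time $t$ is identified with the sequence of steps $(\xi_1,\dots,\xi_t)\in\{-1,1\}^t$. *)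

(* Defs.v *)
From HB Require Import structures.
From mathcomp Require Import all_boot all_order all_algebra finmap.
From mathcomp Require Import all_classical all_reals all_analysis.

Set Implicit Arguments.
Unset Strict Implicit.
Unset Printing Implicit Defensive.

Import Order.TTheory GRing.Theory Num.Theory.
Import numFieldNormedType.Exports.

Local Open Scope classical_set_scope.
Local Open Scope ring_scope.

Definition mutually_independent d (T : measurableType d) (R : realType)
    (P : probability T R) (I : choiceType) (X : I -> {RV P >-> R}) : Prop :=
  forall (J : {fset I}) (A : I -> set R), (forall i, measurable (A i)) ->
    P (\bigcap_(i in [set` J]) X i @^-1` A i) =
    (\prod_(i <- J) P (X i @^-1` A i))%E.

Definition identically_distributed d (T : measurableType d) (R : realType)
    (P : probability T R) (I : Type) (X : I -> {RV P >-> R}) : Prop :=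
  forall (i j : I) (A : set R), measurable A ->
    distribution P (X i) A = distribution P (X j) A.

(* The steps are [xi 1, xi 2, ...]; the value [xi 0] is not used. *)
Fixpoint antlion_walk (T : Type) (R : realType) (alpha : R)
    (xi : nat -> T -> R) (t : nat) (w : T) : R :=
  if t is t'.+1 then alpha * antlion_walk alpha xi t' w + xi t w else 0.

(* [e s] is the value of the step [xi s.+1], for [s = 0, ..., t - 1]. *)
Definition is_path (R : realType) (t : nat) (e : {ffun 'I_t -> R}) : Prop :=
  forall s, e s = -1 \/ e s = 1.

Definition path_endpoint (R : realType) (alpha : R) (t : nat)
    (e : {ffun 'I_t -> R}) : R :=
  \sum_(s < t) alpha ^+ (t - s.+1) * e s.

(* Main.v *)
(* Two distinct paths with the same endpoint would make [alpha] a root of a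
   polynomial with coefficients in [{-1, 0, 1}] whose leading coefficient is
   [1] or [-1]; a rational root of such a polynomial is an integer, which
   [0 < alpha < 1] forbids.  A path to [x] exists because almost surely every
   step is [-1] or [1], so that the event [X_t = x], having positive
   probability, contains an outcome all of whose steps are such. *)

Require Import Defs.
From HB Require Import structures.
From mathcomp Require Import all_boot all_order all_algebra finmap.
From mathcomp Require Import all_classical all_reals all_analysis.
From mathcomp Require Import measurable_realfun ring lra zify.

Set Implicit Arguments.
Unset Strict Implicit.
Unset Printing Implicit Defensive.

Import Order.TTheory GRing.Theory Num.Theory.
Import numFieldNormedType.Exports.

Local Open Scope classical_set_scope.
Local Open Scope ring_scope.

(** The exponents of [q] stay below [t], so multiplying by the [t]-th power of the denominator
    clears every fraction and leaves at least one spare factor [denq q] in each term. *)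
Lemma denq_exp_sum (q : rat) (t : nat) (c : 'I_t -> int) :
  exists k : int, (denq q)%:~R ^+ t * \sum_(s < t) q ^+ (t - s.+1) * (c s)%:~R
    = (denq q * k)%:~R.
Proof.
exists (\sum_(s < t) numq q ^+ (t - s.+1) * denq q ^+ s * c s).
rewrite [RHS]rmorphM /= rmorph_sum /= !mulr_sumr; apply: eq_bigr => s _.
have -> : (denq q)%:~R ^+ t
    = (denq q)%:~R * (denq q)%:~R ^+ (t - s.+1) * (denq q)%:~R ^+ s :> rat.
  by rewrite -exprS -exprD; congr (_ ^+ _); have := ltn_ord s; lia.
rewrite !rmorphM /= !rmorphXn /= numqE exprMn; ring.
Qed.

(** The rational root argument kills the leading coefficient; what remains is a sum of the same
    shape with one term fewer, so induction on [t] kills the others. *)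
Lemma unit_coef_sum_eq0 (q : rat) (t : nat) (c : 'I_t -> int) :
  q \isn't a Num.int -> (forall s, `|c s| <= 1) ->
  \sum_(s < t) q ^+ (t - s.+1) * (c s)%:~R = 0 -> forall s, c s = 0.
Proof.
move=> qNint; elim: t c => [|t IHt] c c_le1; first by move=> _ [].
rewrite big_ord_recl subn1 /= => sum0.
have [k Ek] := denq_exp_sum q (fun s => c (lift ord0 s)).
set tl := \sum_(s < t) q ^+ (t - s.+1) * (c (lift ord0 s))%:~R in Ek.
have {}sum0 : q ^+ t * (c ord0)%:~R + tl = 0 by rewrite -[RHS]sum0.
have c0 : c ord0 = 0.
  (* This is [sum0] multiplied by [denq q ^+ t]: the leading term becomes an integer and the tail a
     multiple of [denq q]. *)
  have num_den : numq q ^+ t * c ord0 = denq q * - k.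
    apply: (@intr_inj rat).
    rewrite mulrN rmorphN /= -Ek rmorphM rmorphXn /= numqE exprMn.
    have -> : tl = - (q ^+ t * (c ord0)%:~R).
      by apply/eqP; rewrite -addr_eq0 addrC sum0.
    ring.
  (* A nonzero [c ord0] is a unit, so [denq q] divides [numq q ^+ t]; being coprime to it, it equals
     1 and [q] is an integer. *)
  apply/eqP; apply: contraNT qNint => c0N0.
  have c0_dvd1 : (c ord0 %| 1)%Z.
    by rewrite dvdz1; have := c_le1 ord0; move: c0N0; lia.
  have den_dvd : (denq q %| numq q ^+ t)%Z.
    apply: (@dvdz_trans (numq q ^+ t * c ord0)).
      by rewrite num_den dvdz_mulr.
    by rewrite -[X in (_ %| X)%Z]mulr1 dvdz_mul.
  have den_coprime : coprimez (denq q) (numq q ^+ t).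
    by rewrite coprimezXr// coprimez_sym; exact: coprime_num_den.
  by rewrite Qint_def -absz_denq eqz_nat -dvdz1
    -(Gauss_dvdzl 1 den_coprime) mul1r.
move=> s; case: (unliftP ord0 s) => [s' ->|-> //].
apply: (IHt (fun s => c (lift ord0 s))) => [//|].
by move: sum0; rewrite c0 mulr0 add0r.
Qed.

Lemma path_endpoint_inj (R : realType) (alpha : R) (t : nat)
    (e e' : {ffun 'I_t -> R}) :
  rational alpha -> 0 < alpha < 1 -> is_path e -> is_path e' ->
  path_endpoint alpha e = path_endpoint alpha e' -> e = e'.
Proof.
move=> [q _ <-] q01 path_e path_e' eq_end.
have qNint : q \isn't a Num.int.
  apply/negP => /intrP[m qm]; move: q01.
  by rewrite qm ratr_int ltr0z ltrz1; lia.
(* Half the difference of the two paths, which takes its values in -1, 0, 1. *)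
pose c s : int := (e s == 1)%:Z - (e' s == 1)%:Z.
have m1_neq1 : ((-1 : R) == 1) = false by apply/eqP; lra.
have e_sub s : e s - e' s = 2 * (c s)%:~R.
  rewrite /c; case: (path_e s) => ->; case: (path_e' s) => ->;
    by rewrite ?eqxx ?m1_neq1 /=; ring.
have c0 : forall s, c s = 0.
  apply: (unit_coef_sum_eq0 qNint) => [s|].
    by rewrite /c; case: eqP; case: eqP.
  (* The vanishing is checked in [R], where twice the sum is the difference of the two endpoints. *)
  apply: (fmorph_inj (@ratr R)); rewrite rmorph0 rmorph_sum /=.
  apply: (@mulfI _ 2); rewrite ?pnatr_eq0// mulr0 mulr_sumr.
  rewrite -[RHS](subrr (path_endpoint (ratr q) e)) [in X in _ = _ - X]eq_end.
  rewrite /path_endpoint -sumrB; apply: eq_bigr => s _.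
  rewrite -mulrBr e_sub rmorphM rmorphXn /= ratr_int; ring.
by apply/ffunP => s; apply/eqP; rewrite -subr_eq0 e_sub c0 mulr0.
Qed.

Lemma antlion_walkE (T : Type) (R : realType) (alpha : R) (xi : nat -> T -> R)
    (t : nat) (w : T) :
  antlion_walk alpha xi t w = path_endpoint alpha [ffun s : 'I_t => xi s.+1 w].
Proof.
rewrite /path_endpoint; elim: t => [|t IHt]; first by rewrite big_ord0.
rewrite big_ord_recr /= IHt subnn ffunE mul1r mulr_sumr; congr (_ + _).
apply: eq_bigr => s _; rewrite !ffunE mulrA -exprS.
by congr (_ ^+ _ * _); have := ltn_ord s; lia.
Qed.

Lemma measurable_antlion_walk (d : measure_display) (T : measurableType d)
    (R : realType) (alpha : R) (xi : nat -> T -> R) (t : nat) :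
  (forall s, measurable_fun setT (xi s)) ->
  measurable_fun setT (antlion_walk alpha xi t).
Proof.
move=> mxi; elim: t => [|t IHt]; first exact: measurable_cst.
by apply: measurable_funD => //; apply: measurable_funM.
Qed.

(** The two events are disjoint and their probabilities add up to 1, so the complement of their
    union is null. *)
Lemma ae_two_values (d : measure_display) (T : measurableType d) (R : realType)
    (P : probability T R) (X : {RV P >-> R}) (a b p : R) :
  a != b -> P [set w | X w = a] = p%:E -> P [set w | X w = b] = (1 - p)%:E ->
  \forall w \ae P, X w = a \/ X w = b.
Proof.
move=> aDb Pa Pb.
have mX (r : R) : measurable [set w | X w = r].
  exact: (@measurable_funPTI _ _ _ _ X [set r] (measurable_set1 r)).
have mab := measurableU _ _ (mX a) (mX b).
apply/negligibleP; first exact: measurableC mab.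
have := probability_setC P mab; rewrite measureU//; last first.
  by apply/seteqP; split => // w [/= ->] /eqP; apply/negP.
by rewrite /= Pa Pb -EFinD addrCA subrr addr0 subrr.
Qed.

Theorem proposition3p2 (R : realType) (d : measure_display)
    (T : measurableType d) (P : probability T R) (alpha p : R)
    (xi : nat -> {RV P >-> R})
    (alpha_rational : rational alpha) (alpha01 : 0 < alpha < 1)
    (p01 : 0 <= p <= 1)
    (xi_indep : mutually_independent (fun s : nat => xi s.+1))
    (xi_ident : identically_distributed (fun s : nat => xi s.+1))
    (xi_m1 : forall s : nat, (0 < s)%N -> P [set w | xi s w = -1] = p%:E)
    (xi_1 : forall s : nat, (0 < s)%N -> P [set w | xi s w = 1] = (1 - p)%:E)
    (t : nat) (t_gt0 : (0 < t)%N) (x : R)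
    (x_reached : (0 < P [set w | antlion_walk alpha xi t w = x])%E) :
  exists! e : {ffun 'I_t -> R}, is_path e /\ path_endpoint alpha e = x.
Proof.
have steps_ae : \forall w \ae P, forall s, xi s.+1 w = -1 \/ xi s.+1 w = 1.
  apply: ae_foralln => s; apply: (ae_two_values _ (xi_m1 _ _) (xi_1 _ _)) => //.
  by apply/eqP; lra.
have [w [wx w_steps]] : exists w, antlion_walk alpha xi t w = x /\
    forall s, xi s.+1 w = -1 \/ xi s.+1 w = 1.
  (* Without such an outcome, the event that the walk is at [x] would lie in the null set where some
     step is neither -1 nor 1. *)
  apply: contrapT => no_w; move: x_reached; rewrite measure_negligible ?ltxx//.
    rewrite -[X in measurable X]setTI.
    have mwalk : measurable_fun setT (antlion_walk alpha xi t).
      by apply: measurable_antlion_walk.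
    exact: (mwalk measurableT [set x] (measurable_set1 x)).
  by apply: negligibleS steps_ae => w /= wx w_steps; apply: no_w; exists w.
exists [ffun s : 'I_t => xi s.+1 w]; split.
  by split=> [s|]; [rewrite ffunE | rewrite -wx antlion_walkE].
move=> e [path_e e_x]; apply: (path_endpoint_inj alpha_rational alpha01) => //.
  by move=> s; rewrite ffunE.
by rewrite e_x -wx antlion_walkE.
Qed.
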